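(* Let $d\in\mathbb{N}$. Then the second Hochschild cohomology group of $\mathrm{Pol}(U_d^+)$ with trivial coefficients satisfies $$H^2(U_d^+,{}_\epsilon\mathbb{C}_\epsilon)\cong\mathbb{C}^{d^2-1}.$$ Furthermore, for $d\ge2$ the set $$\{[K_{m,n}]:m\ne n,\ m,n=1,\ldots,d\}\cup\{[K_p]:p=1,\ldots,d-1\}$$ is a basis of $H^2(U_d^+,{}_\epsilon\mathbb{C}_\epsilon)$, where $K_{m,n}$ and $K_p$ are the 2-cocycles defined in the context.
   Context: $A=\mathrm{Pol}(U_d^+)$ is the universal unital $^*$-algebra generated by $u_{jk}$, $1\le j,k\le d$, subject to $uu^*=u^*u=I$ and $\bar uu^t=u^t\bar u=I$, where $u=(u_{jk})$, $\bar u=(u_{jk}^* )$, $u^t=(u_{kj})$. Its character $\epsilon$ is the unital $^*$-homomorphism to $\mathbb{C}$ with $\epsilon(u_{jk})=\delta_{jk}$. Hochschild cohomology with trivial coefficients ($\mathbb{C}$ as an $A$-bimodule via $a.z.b=\epsilon(a)\epsilon(b)z$): for linear $\phi:A^{\otimes(n-1)}\to\mathbb{C}$, $$(\partial^{n-1}\phi)(a_1\otimes\cdots\otimes a_n)=\epsilon(a_1)\phi(a_2\otimes\cdots\otimes a_n)+\sum_{j=1}^{n-1}(-1)^j\phi(a_1\otimes\cdots\otimes a_ja_{j+1}\otimes\cdots\otimes a_n)+(-1)^n\phi(a_1\otimes\cdots\otimes a_{n-1})\epsilon(a_n).$$ $Z^2=\{c\in L(A^{\otimes2};\mathbb{C}):\partial^2c=0\}$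 (2-cocycles), $B^2=\{\partial^1\psi:\psi\in L(A;\mathbb{C})\}$ (coboundaries), $H^2(U_d^+,{}_\epsilon\mathbb{C}_\epsilon)=Z^2/B^2$, a complex vector space; $[c]$ is the class of $c$. For every $V\in M_d(\mathbb{C})$ there is a unique linear map $\eta_V:A\to\mathbb{C}$ with $\eta_V(ab)=\epsilon(a)\eta_V(b)+\eta_V(a)\epsilon(b)$ for all $a,b\in A$ (a Gaussian cocycle) and $\eta_V(u_{jk})=V_{jk}$; it satisfies $\eta_V(u_{jk}^* )=-V_{kj}$. For such maps $\eta_1,\eta_2$, the formula $K(\eta_1,\eta_2)(a\otimes b)=\overline{\eta_1(a^* )}\,\eta_2(b)$ defines a 2-cocycle. Let $e_{jk}$ be the matrix units of $M_d(\mathbb{C})$. For $m\ne n$ choose an arbitrary index $l=l(m,n)\in\{1,\ldots,d\}$ and set $K_{m,n}=K(\eta_{e_{lm}},\eta_{e_{ln}})$. For $p\in\{1,\ldots,d-1\}$ let $V_p\in M_d(\mathbb{C})$ have entries $(V_p)_{p,p}=1$, $(V_p)_{p,p+1}=i$, $(V_p)_{p+1,p+1}=1$ and all other entries $0$ ($i$ the imaginary unit), and set $K_p=K(\eta_{V_p},\eta_{V_p})$. *)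

(* Defs.v *)
From HB Require Import structures.
From mathcomp Require Import all_boot all_order all_algebra ring_quotient.
From mathcomp Require Import ring.
From mathcomp Require Import boolp classical_sets functions reals complex.

Set Implicit Arguments.
Unset Strict Implicit.
Unset Printing Implicit Defensive.

Import Order.TTheory GRing.Theory Num.Theory.
Local Open Scope ring_scope.
Local Open Scope quotient_scope.

(* ------------------------------------------------------------------------ *)
(* Pol(U_d^+): unital algebra expressions in the letters u_jk and u_jk^*,   *)
(* modulo the smallest congruence containing the algebra laws and the       *)
(* relations u u^* = u^* u = I, ubar u^t = u^t ubar = I.  The set of        *)
(* relations is stable under the involution, so this is also the universal  *)
(* *-algebra (polU_universal below).                                        *)
(* ------------------------------------------------------------------------ *)

Section Terms.
Variables (C : numClosedFieldType) (d : nat).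

Inductive term : Type :=
| TScal of C                  (* z.1 *)
| TGen  of 'I_d & 'I_d        (* u_jk *)
| TGenS of 'I_d & 'I_d        (* u_jk^* *)
| TAdd  of term & term
| TMul  of term & term.

HB.instance Definition _ := gen_eqMixin term.
HB.instance Definition _ := gen_choiceMixin term.

Definition tdelta (j k : 'I_d) : term := TScal (j == k)%:R.
Definition tsum (F : 'I_d -> term) : term := \big[TAdd/TScal 0]_(p < d) F p.

Inductive teq : term -> term -> Prop :=
| teq_refl s : teq s s
| teq_sym s t : teq s t -> teq t s
| teq_trans s t r : teq s t -> teq t r -> teq s r
| teq_add s s' t t' : teq s s' -> teq t t' -> teq (TAdd s t) (TAdd s' t')
| teq_mul s s' t t' : teq s s' -> teq t t' -> teq (TMul s t) (TMul s' t')
| teq_addA s t r : teq (TAdd s (TAdd t r)) (TAdd (TAdd s t) r)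
| teq_addC s t : teq (TAdd s t) (TAdd t s)
| teq_add0 s : teq (TAdd (TScal 0) s) s
| teq_addN s : teq (TAdd (TMul (TScal (-1)) s) s) (TScal 0)
| teq_mulA s t r : teq (TMul s (TMul t r)) (TMul (TMul s t) r)
| teq_mul1 s : teq (TMul (TScal 1) s) s
| teq_mulDl s t r : teq (TMul (TAdd s t) r) (TAdd (TMul s r) (TMul t r))
| teq_mulDr s t r : teq (TMul r (TAdd s t)) (TAdd (TMul r s) (TMul r t))
| teq_scalD y z : teq (TScal (y + z)) (TAdd (TScal y) (TScal z))
| teq_scalM y z : teq (TScal (y * z)) (TMul (TScal y) (TScal z))
| teq_scalC z s : teq (TMul (TScal z) s) (TMul s (TScal z))
| teq_uuS j k :             (* u u^* = I *)
    teq (tsum (fun p => TMul (TGen j p) (TGenS k p))) (tdelta j k)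
| teq_uSu j k :             (* u^* u = I *)
    teq (tsum (fun p => TMul (TGenS p j) (TGen p k))) (tdelta j k)
| teq_ubut j k :            (* ubar u^t = I *)
    teq (tsum (fun p => TMul (TGenS j p) (TGen k p))) (tdelta j k)
| teq_utub j k :            (* u^t ubar = I *)
    teq (tsum (fun p => TMul (TGen p j) (TGenS p k))) (tdelta j k).

Definition teqb (s t : term) : bool := `[< teq s t >].

Lemma teqb_is_equiv : equiv_class_of teqb.
Proof.
split=> [s|s t|t s r].
- by apply/asboolP; exact: teq_refl.
- by apply/asboolP/asboolP; exact: teq_sym.
- by move=> /asboolP st /asboolP tr; apply/asboolP; exact: teq_trans tr.
Qed.
Canonical teqb_equiv := EquivRelPack teqb_is_equiv.
Canonical teqb_encModRel := defaultEncModRel teqb.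

Definition polU : Type := {eq_quot teqb}.
HB.instance Definition _ := Choice.on polU.
HB.instance Definition _ : EqQuotient term teqb polU := EqQuotient.on polU.

Definition tpi (s : term) : polU := \pi_polU s.

Lemma tpiP s t : teq s t <-> tpi s = tpi t.
Proof. by split=> [st|/eqmodP/asboolP//]; apply/eqmodP/asboolP. Qed.

Lemma tpiK (a : polU) : tpi (repr a) = a.
Proof. exact: reprK. Qed.

Lemma tpi_repr s : teq (repr (tpi s)) s.
Proof. by apply/tpiP; rewrite tpiK. Qed.

Lemma polU_ind (P : polU -> Prop) : (forall s, P (tpi s)) -> forall a, P a.
Proof. by move=> h a; rewrite -(tpiK a). Qed.

Fixpoint teps (t : term) : C :=
  match t with
  | TScal z => z
  | TGen j k => (j == k)%:R
  | TGenS j k => (j == k)%:R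
  | TAdd s t => teps s + teps t
  | TMul s t => teps s * teps t
  end.

Fixpoint teta (V : 'M[C]_d) (t : term) : C :=
  match t with
  | TScal _ => 0
  | TGen j k => V j k
  | TGenS j k => - V k j
  | TAdd s t => teta V s + teta V t
  | TMul s t => teps s * teta V t + teta V s * teps t
  end.

Fixpoint tstar (t : term) : term :=
  match t with
  | TScal z => TScal z^*
  | TGen j k => TGenS j k
  | TGenS j k => TGen j k
  | TAdd s t => TAdd (tstar s) (tstar t)
  | TMul s t => TMul (tstar t) (tstar s)
  end.

Lemma teps_sum F : teps (tsum F) = \sum_p teps (F p).
Proof. exact: (big_morph teps (id1 := 0) (op1 := +%R)). Qed.

Lemma teta_sum V F : teta V (tsum F) = \sum_p teta V (F p).
Proof. exact: (big_morph (teta V) (id1 := 0) (op1 := +%R)). Qed.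

Lemma tstar_sum F : tstar (tsum F) = tsum (fun p => tstar (F p)).
Proof.
by apply: (big_morph tstar (id1 := TScal 0) (op1 := TAdd)) => //=; rewrite conjC0.
Qed.

Lemma sum_deltal (F : 'I_d -> C) j : \sum_p (j == p)%:R * F p = F j.
Proof.
rewrite (bigD1 j) //= eqxx mul1r big1 ?addr0 // => p.
by rewrite eq_sym => /negPf ->; rewrite mul0r.
Qed.

Lemma sum_deltar (F : 'I_d -> C) j : \sum_p F p * (j == p)%:R = F j.
Proof. by rewrite -[RHS](sum_deltal F); apply: eq_bigr => p _; rewrite mulrC. Qed.

Let sum_deltal' (F : 'I_d -> C) j : \sum_p (p == j)%:R * F p = F j.
Proof. by rewrite -[RHS](sum_deltal F); apply: eq_bigr => p _; rewrite eq_sym. Qed.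
Let sum_deltar' (F : 'I_d -> C) j : \sum_p F p * (p == j)%:R = F j.
Proof. by rewrite -[RHS](sum_deltar F); apply: eq_bigr => p _; rewrite eq_sym. Qed.

Lemma teps_teq s t : teq s t -> teps s = teps t.
Proof.
elim=> {s t} //=.
- by move=> s t r _ -> _ ->.
- by move=> s s' t t' _ -> _ ->.
- by move=> s s' t t' _ -> _ ->.
- by move=> *; rewrite addrA.
- by move=> *; rewrite addrC.
- by move=> *; rewrite add0r.
- by move=> *; rewrite mulN1r addNr.
- by move=> *; rewrite mulrA.
- by move=> *; rewrite mul1r.
- by move=> *; rewrite mulrDl.
- by move=> *; rewrite mulrDr.
- by move=> *; rewrite mulrC.
- by move=> j k; rewrite teps_sum /= sum_deltal eq_sym.
- by move=> j k; rewrite teps_sum /= sum_deltal'.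
- by move=> j k; rewrite teps_sum /= sum_deltal eq_sym.
- by move=> j k; rewrite teps_sum /= sum_deltal'.
Qed.

Lemma teta_teq V s t : teq s t -> teta V s = teta V t.
Proof.
elim=> {s t} //=.
- by move=> s t r _ -> _ ->.
- by move=> s s' t t' _ -> _ ->.
- move=> s s' t t' /teps_teq es h1 /teps_teq et h2.
  by rewrite es et h1 h2.
- by move=> *; rewrite addrA.
- by move=> *; rewrite addrC.
- by move=> *; rewrite add0r.
- by move=> s; rewrite mulN1r mul0r addr0 addNr.
- by move=> s t r; rewrite mulrDr mulrDl !mulrA addrA.
- by move=> s; rewrite mul1r mul0r addr0.
- by move=> s t r; rewrite !mulrDl addrACA.
- by move=> s t r; rewrite !mulrDr addrACA.
- by move=> *; rewrite addr0.
- by move=> *; rewrite mulr0 mul0r addr0.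
- by move=> z s; rewrite mul0r mulr0 addr0 add0r mulrC.
- by move=> j k; rewrite teta_sum /= big_split /= sum_deltal sum_deltar addNr.
- by move=> j k; rewrite teta_sum /= big_split /= sum_deltal' sum_deltar' addrN.
- by move=> j k; rewrite teta_sum /= big_split /= sum_deltal sum_deltar addrN.
- by move=> j k; rewrite teta_sum /= big_split /= sum_deltal' sum_deltar' addNr.
Qed.

Lemma tdeltaC j k : tstar (tdelta j k) = tdelta k j.
Proof. by rewrite /= /tdelta rmorph_nat eq_sym. Qed.

Lemma tstar_teq s t : teq s t -> teq (tstar s) (tstar t).
Proof.
elim=> {s t}.
- by move=> s; exact: teq_refl.
- by move=> s t _; exact: teq_sym.
- by move=> s t r _ h1 _; exact: teq_trans h1.
- by move=> s s' t t' _ h1 _ h2; exact: teq_add.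
- by move=> s s' t t' _ h1 _ h2; exact: teq_mul.
- by move=> s t r; exact: teq_addA.
- by move=> s t; exact: teq_addC.
- by move=> s /=; rewrite conjC0; exact: teq_add0.
- move=> s /=; rewrite conjC0 rmorphN1.
  apply: teq_trans (teq_addN (tstar s)); apply: teq_add; last exact: teq_refl.
  exact: teq_sym (teq_scalC _ _).
- by move=> s t r /=; apply: teq_sym; exact: teq_mulA.
- move=> s /=; rewrite conjC1; apply: teq_trans (teq_mul1 _).
  exact: teq_sym (teq_scalC _ _).
- by move=> s t r; exact: teq_mulDr.
- by move=> s t r; exact: teq_mulDl.
- by move=> y z /=; rewrite rmorphD; exact: teq_scalD.
- by move=> y z /=; rewrite rmorphM mulrC; exact: teq_scalM.
- by move=> z s /=; apply: teq_sym; exact: teq_scalC.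
- by move=> j k; rewrite tdeltaC tstar_sum; exact: teq_uuS.
- by move=> j k; rewrite tdeltaC tstar_sum; exact: teq_uSu.
- by move=> j k; rewrite tdeltaC tstar_sum; exact: teq_ubut.
- by move=> j k; rewrite tdeltaC tstar_sum; exact: teq_utub.
Qed.

Lemma tstarK : involutive tstar.
Proof.
elim=> [z|j k|j k|s hs t ht|s hs t ht] //=; first by rewrite conjCK.
- by rewrite hs ht.
- by rewrite hs ht.
Qed.

Definition padd (a b : polU) : polU := tpi (TAdd (repr a) (repr b)).
Definition pmul (a b : polU) : polU := tpi (TMul (repr a) (repr b)).
Definition popp (a : polU) : polU := tpi (TMul (TScal (-1)) (repr a)).
Definition pscal (z : C) (a : polU) : polU := tpi (TMul (TScal z) (repr a)).

Lemma paddE s t : padd (tpi s) (tpi t) = tpi (TAdd s t).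
Proof. by apply/tpiP; apply: teq_add; exact: tpi_repr. Qed.
Lemma pmulE s t : pmul (tpi s) (tpi t) = tpi (TMul s t).
Proof. by apply/tpiP; apply: teq_mul; exact: tpi_repr. Qed.
Lemma poppE s : popp (tpi s) = tpi (TMul (TScal (-1)) s).
Proof. by apply/tpiP; apply: teq_mul; [exact: teq_refl|exact: tpi_repr]. Qed.
Lemma pscalE z s : pscal z (tpi s) = tpi (TMul (TScal z) s).
Proof. by apply/tpiP; apply: teq_mul; [exact: teq_refl|exact: tpi_repr]. Qed.

Let pE := (paddE, pmulE, poppE, pscalE).

Lemma paddA : associative padd.
Proof.
elim/polU_ind=> s; elim/polU_ind=> t; elim/polU_ind=> r.
by rewrite !pE; apply/tpiP; constructor.
Qed.
Lemma paddC : commutative padd.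
Proof.
elim/polU_ind=> s; elim/polU_ind=> t.
by rewrite !pE; apply/tpiP; constructor.
Qed.
Lemma padd0 : left_id (tpi (TScal 0)) padd.
Proof. by elim/polU_ind=> s; rewrite !pE; apply/tpiP; constructor. Qed.
Lemma paddN : left_inverse (tpi (TScal 0)) popp padd.
Proof. by elim/polU_ind=> s; rewrite !pE; apply/tpiP; constructor. Qed.
Lemma pmulA : associative pmul.
Proof.
elim/polU_ind=> s; elim/polU_ind=> t; elim/polU_ind=> r.
by rewrite !pE; apply/tpiP; constructor.
Qed.
Lemma pmul1l : left_id (tpi (TScal 1)) pmul.
Proof. by elim/polU_ind=> s; rewrite !pE; apply/tpiP; constructor. Qed.
Lemma pmul1r : right_id (tpi (TScal 1)) pmul.
Proof.
elim/polU_ind=> s; rewrite !pE; apply/tpiP.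
by apply: teq_trans (teq_mul1 s); apply: teq_sym; constructor.
Qed.
Lemma pmulDl : left_distributive pmul padd.
Proof.
elim/polU_ind=> s; elim/polU_ind=> t; elim/polU_ind=> r.
by rewrite !pE; apply/tpiP; constructor.
Qed.
Lemma pmulDr : right_distributive pmul padd.
Proof.
elim/polU_ind=> s; elim/polU_ind=> t; elim/polU_ind=> r.
by rewrite !pE; apply/tpiP; constructor.
Qed.
Lemma pone_neq0 : tpi (TScal 1) != tpi (TScal 0).
Proof. by apply/eqP => /tpiP /teps_teq /= /eqP; rewrite oner_eq0. Qed.

HB.instance Definition _ := GRing.isNzRing.Build polU
  paddA paddC padd0 paddN pmulA pmul1l pmul1r pmulDl pmulDr pone_neq0.

Lemma pscalA a b v : pscal a (pscal b v) = pscal (a * b) v.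
Proof.
elim/polU_ind: v => s; rewrite !pE; apply/tpiP.
apply: teq_trans (teq_mulA _ _ _) _; apply: teq_mul (teq_refl _).
by apply: teq_sym; constructor.
Qed.
Lemma pscal1 : left_id 1 pscal.
Proof. by elim/polU_ind=> s; rewrite !pE; apply/tpiP; constructor. Qed.
Lemma pscalDr : right_distributive pscal +%R.
Proof.
move=> z; elim/polU_ind=> s; elim/polU_ind=> t.
by rewrite /GRing.add /= !pE; apply/tpiP; constructor.
Qed.
Lemma pscalDl v : {morph pscal^~ v : a b / a + b}.
Proof.
move=> y z; elim/polU_ind: v => s; rewrite /GRing.add /= !pE; apply/tpiP.
apply: teq_trans (teq_mulDl _ _ _); apply: teq_mul (teq_refl _).
exact: teq_scalD.
Qed.
HB.instance Definition _ := GRing.Zmodule_isLmodule.Build C polU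
  pscalA pscal1 pscalDr pscalDl.

Lemma pscalAl (z : C) (a b : polU) : z *: (a * b) = (z *: a) * b.
Proof.
elim/polU_ind: a => s; elim/polU_ind: b => t.
by rewrite /GRing.mul /GRing.scale /= !pE; apply/tpiP; constructor.
Qed.
HB.instance Definition _ := GRing.Lmodule_isLalgebra.Build C polU pscalAl.

Lemma pscalAr (z : C) (a b : polU) : z *: (a * b) = a * (z *: b).
Proof.
elim/polU_ind: a => s; elim/polU_ind: b => t.
rewrite /GRing.mul /GRing.scale /= !pE; apply/tpiP.
apply: teq_trans (teq_mulA _ _ _) _.
apply: teq_trans (teq_sym (teq_mulA _ _ _)).
by apply: teq_mul (teq_refl _); constructor.
Qed.
HB.instance Definition _ := GRing.Lalgebra_isAlgebra.Build C polU pscalAr.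

Lemma tpiD s t : tpi (TAdd s t) = tpi s + tpi t.
Proof. by rewrite /GRing.add /= paddE. Qed.
Lemma tpiM s t : tpi (TMul s t) = tpi s * tpi t.
Proof. by rewrite /GRing.mul /= pmulE. Qed.
Lemma tpiZ z : tpi (TScal z) = z%:A.
Proof.
have -> : z%:A = pscal z (tpi (TScal 1)) by [].
by rewrite pscalE; apply/tpiP; rewrite -{1}[z]mulr1; exact: teq_scalM.
Qed.
Lemma tpi_sum F : tpi (tsum F) = \sum_p tpi (F p).
Proof. by apply: (big_morph tpi (id1 := 0) (op1 := +%R)) => // s t; exact: tpiD. Qed.

Definition gen (j k : 'I_d) : polU := tpi (TGen j k).
Definition star (a : polU) : polU := tpi (tstar (repr a)).
Definition counit (a : polU) : C := teps (repr a).
Definition eta (V : 'M[C]_d) (a : polU) : C := teta V (repr a).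

Lemma starE s : star (tpi s) = tpi (tstar s).
Proof. by apply/tpiP/tstar_teq/tpi_repr. Qed.
Lemma counitE s : counit (tpi s) = teps s.
Proof. exact: teps_teq (tpi_repr s). Qed.
Lemma etaE V s : eta V (tpi s) = teta V s.
Proof. exact: teta_teq (tpi_repr s). Qed.

Lemma starK : involutive star.
Proof. by elim/polU_ind=> s; rewrite !starE tstarK. Qed.
Lemma starD a b : star (a + b) = star a + star b.
Proof.
by elim/polU_ind: a => s; elim/polU_ind: b => t; rewrite !(starE, =^~ tpiD).
Qed.
Lemma starM a b : star (a * b) = star b * star a.
Proof.
by elim/polU_ind: a => s; elim/polU_ind: b => t; rewrite !(starE, =^~ tpiM).
Qed.
Lemma starZ z a : star (z *: a) = z^* *: star a.
Proof.
elim/polU_ind: a => s.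
rewrite starE ![_ *: tpi _]pscalE starE; apply/tpiP.
exact: teq_sym (teq_scalC _ _).
Qed.

Lemma counitD a b : counit (a + b) = counit a + counit b.
Proof.
by elim/polU_ind: a => s; elim/polU_ind: b => t; rewrite -tpiD !counitE.
Qed.
Lemma counitM a b : counit (a * b) = counit a * counit b.
Proof.
by elim/polU_ind: a => s; elim/polU_ind: b => t; rewrite -tpiM !counitE.
Qed.
Lemma counit1 : counit 1 = 1. Proof. exact: (counitE (TScal 1)). Qed.
Lemma counitZ z a : counit (z *: a) = z * counit a.
Proof.
by rewrite -[a in LHS]mul1r scalerAl -tpiZ counitM counitE.
Qed.
Lemma counit_star a : counit (star a) = (counit a)^*.
Proof.
elim/polU_ind: a => s; rewrite starE !counitE.
elim: s => [z|j k|j k|s hs t ht|s hs t ht] //=; rewrite ?rmorph_nat //.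
- by rewrite rmorphD hs ht.
- by rewrite rmorphM hs ht mulrC.
Qed.
Lemma counit_gen j k : counit (gen j k) = (j == k)%:R.
Proof. exact: counitE. Qed.

Lemma etaD V a b : eta V (a + b) = eta V a + eta V b.
Proof. by elim/polU_ind: a => s; elim/polU_ind: b => t; rewrite -tpiD !etaE. Qed.
Lemma etaM V a b : eta V (a * b) = counit a * eta V b + eta V a * counit b.
Proof.
by elim/polU_ind: a => s; elim/polU_ind: b => t; rewrite -tpiM !etaE !counitE.
Qed.
Lemma etaZ V z a : eta V (z *: a) = z * eta V a.
Proof.
by rewrite -[a in LHS]mul1r scalerAl -tpiZ etaM etaE counitE /= mul0r addr0.
Qed.
Lemma eta_gen V j k : eta V (gen j k) = V j k.
Proof. exact: etaE. Qed.
Lemma eta_gen_star V j k : eta V (star (gen j k)) = - V k j.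
Proof. by rewrite starE etaE. Qed.

Lemma eta_unique (V : 'M[C]_d) (f : polU -> C) :
  (forall z a b, f (z *: a + b) = z * f a + f b) ->
  (forall a b, f (a * b) = counit a * f b + f a * counit b) ->
  (forall j k, f (gen j k) = V j k) -> f =1 eta V.
Proof.
move=> fL fM fV.
have fD a b : f (a + b) = f a + f b by rewrite -[a]scale1r fL mul1r scale1r.
have f0 : f 0 = 0 by apply: (@addrI _ (f 0)); rewrite -fD !addr0.
have fZ z a : f (z *: a) = z * f a by rewrite -[z *: a]addr0 fL f0 addr0.
have f1 : f 1 = 0.
  by apply: (@addrI _ (f 1)); rewrite addr0 -[in RHS](mulr1 1) fM counit1 mul1r mulr1.
have fS j k : f (tpi (TGenS j k)) = - V k j.
  have := fM (\sum_p tpi (TGenS j p) * 1) 1.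
  have /tpiP := teq_ubut j k; rewrite tpi_sum tpiZ => /(congr1 f).
  rewrite (big_morph f (id1 := 0) (op1 := +%R)) // fZ f1 mulr0 => h _.
  move: h; under eq_bigr => p _.
    rewrite tpiM fM counitE /= -[tpi (TGen k p)]/(gen k p) fV counit_gen.
    over.
  by rewrite big_split /= sum_deltal sum_deltar => /eqP; rewrite addrC addr_eq0 => /eqP.
elim/polU_ind; elim=> [z|j k|j k|s hs t ht|s hs t ht].
- by rewrite tpiZ fZ etaZ f1 -[1 in RHS]/(tpi (TScal 1)) etaE.
- by rewrite fV eta_gen.
- by rewrite fS etaE.
- by rewrite tpiD fD etaD hs ht.
- by rewrite tpiM fM etaM hs ht.
Qed.

Definition genmx : 'M[polU]_d := \matrix_(j, k) gen j k.

Lemma genmx_relations :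
  [/\ genmx *m (map_mx star genmx)^T = 1%:M,
      (map_mx star genmx)^T *m genmx = 1%:M,
      map_mx star genmx *m genmx^T = 1%:M &
      genmx^T *m map_mx star genmx = 1%:M].
Proof.
split; apply/matrixP => j k; rewrite !mxE.
- have /tpiP := teq_uuS j k; rewrite tpi_sum tpiZ scaler_nat => <-.
  by apply: eq_bigr => p _; rewrite !mxE starE tpiM.
- have /tpiP := teq_uSu j k; rewrite tpi_sum tpiZ scaler_nat => <-.
  by apply: eq_bigr => p _; rewrite !mxE starE tpiM.
- have /tpiP := teq_ubut j k; rewrite tpi_sum tpiZ scaler_nat => <-.
  by apply: eq_bigr => p _; rewrite !mxE starE tpiM.
- have /tpiP := teq_utub j k; rewrite tpi_sum tpiZ scaler_nat => <-.
  by apply: eq_bigr => p _; rewrite !mxE starE tpiM.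
Qed.

Theorem polU_universal (B : algType C) (sB : B -> B) (v : 'M[B]_d) :
  involutive sB -> (forall a b, sB (a + b) = sB a + sB b) ->
  (forall a b, sB (a * b) = sB b * sB a) ->
  (forall (z : C) a, sB (z *: a) = z^* *: sB a) ->
  v *m (map_mx sB v)^T = 1%:M -> (map_mx sB v)^T *m v = 1%:M ->
  map_mx sB v *m v^T = 1%:M -> v^T *m map_mx sB v = 1%:M ->
  let hom (f : {lrmorphism polU -> B}) :=
    (forall a, f (star a) = sB (f a)) /\ (forall j k, f (gen j k) = v j k) in
  exists2 f, hom f & forall g, hom g -> g =1 f.
Proof.
move=> sBK sBD sBM sBZ r1 r2 r3 r4 hom.
have sB1 : sB 1 = 1 by have := sBM (sB 1) 1; rewrite mulr1 !sBK mulr1 => <-.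
pose fix ev (t : term) : B :=
  match t with
  | TScal z => z%:A
  | TGen j k => v j k
  | TGenS j k => sB (v j k)
  | TAdd s t => ev s + ev t
  | TMul s t => ev s * ev t
  end.
have ev_sum F : ev (tsum F) = \sum_p ev (F p).
  by apply: (big_morph ev (id1 := 0) (op1 := +%R)) => //=; rewrite scale0r.
have ev_teq s t : teq s t -> ev s = ev t.
  elim=> {s t} //=.
  - by move=> s t r _ -> _ ->.
  - by move=> s s' t t' _ -> _ ->.
  - by move=> s s' t t' _ -> _ ->.
  - by move=> *; rewrite addrA.
  - by move=> *; rewrite addrC.
  - by move=> *; rewrite scale0r add0r.
  - by move=> *; rewrite scaleN1r mulN1r addNr scale0r.
  - by move=> *; rewrite mulrA.
  - by move=> *; rewrite scale1r mul1r.
  - by move=> *; rewrite mulrDl.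
  - by move=> *; rewrite mulrDr.
  - by move=> *; rewrite scalerDl.
  - by move=> *; rewrite -scalerAl mul1r scalerA.
  - by move=> *; rewrite -scalerAl mul1r -scalerAr mulr1.
  - move=> j k; have /matrixP/(_ j k) := r1; rewrite !mxE ev_sum scaler_nat => <-.
    by apply: eq_bigr => p _; rewrite !mxE.
  - move=> j k; have /matrixP/(_ j k) := r2; rewrite !mxE ev_sum scaler_nat => <-.
    by apply: eq_bigr => p _; rewrite !mxE.
  - move=> j k; have /matrixP/(_ j k) := r3; rewrite !mxE ev_sum scaler_nat => <-.
    by apply: eq_bigr => p _; rewrite !mxE.
  - move=> j k; have /matrixP/(_ j k) := r4; rewrite !mxE ev_sum scaler_nat => <-.
    by apply: eq_bigr => p _; rewrite !mxE.
pose f (a : polU) : B := ev (repr a).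
have fE s : f (tpi s) = ev s by exact: ev_teq (tpi_repr s).
have fD a b : f (a + b) = f a + f b.
  by elim/polU_ind: a => s; elim/polU_ind: b => t; rewrite -tpiD !fE.
have fM a b : f (a * b) = f a * f b.
  by elim/polU_ind: a => s; elim/polU_ind: b => t; rewrite -tpiM !fE.
have f1 : f 1 = 1 by rewrite -[1 in LHS]/(tpi (TScal 1)) fE /= scale1r.
have fZ z a : f (z *: a) = z *: f a.
  by rewrite -[a in LHS]mul1r scalerAl -tpiZ fM fE /= -scalerAl mul1r.
have f0 : f 0 = 0 by rewrite -[0 in LHS]/(tpi (TScal 0)) fE /= scale0r.
have fB : zmod_morphism f.
  by move=> a b; rewrite -scaleN1r fD fZ scaleN1r.
pose zM := GRing.isZmodMorphism.Build polU B f fB.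
pose mM := GRing.isMonoidMorphism.Build polU B f (f1, fM).
pose sM := GRing.isScalable.Build C polU B *:%R f fZ.
pose fL : {lrmorphism polU -> B} := HB.pack f zM mM sM.
have fLE : fL =1 f by [].
exists fL.
  split=> [a|j k]; last by rewrite fLE fE.
  rewrite !fLE; elim/polU_ind: a => s; rewrite starE !fE.
  elim: s => [z|j k|j k|s hs t ht|s hs t ht] //=.
  - by rewrite sBZ sB1.
  - by rewrite sBD hs ht.
  - by rewrite sBM hs ht.
move=> g [gS gU]; elim/polU_ind => s; rewrite fLE fE.
elim: s => [z|j k|j k|s hs t ht|s hs t ht] /=.
- by rewrite tpiZ linearZ /= rmorph1.
- exact: gU.
- by rewrite -gU -gS starE.
- by rewrite tpiD rmorphD /= hs ht.
- by rewrite tpiM rmorphM /= hs ht.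
Qed.

End Terms.

(* ------------------------------------------------------------------------ *)
(* Hochschild cohomology of an algebra A with trivial coefficients, with    *)
(* respect to a character eps.  L(A^{(x) n}; C) is represented by the       *)
(* n-linear maps on families indexed by 'I_n.                               *)
(* ------------------------------------------------------------------------ *)

Section Hochschild.
Variables (C : numClosedFieldType) (A : algType C) (eps : A -> C).

Definition cochain (n : nat) : Type := ('I_n -> A) -> C^o.
HB.instance Definition _ n := GRing.Lmodule.on (cochain n).

Definition upd n (a : 'I_n -> A) (i : 'I_n) (x : A) : 'I_n -> A :=
  fun j => if j == i then x else a j.

Definition multilinear n (phi : cochain n) : Prop :=
  forall (a : 'I_n -> A) (i : 'I_n) (z : C) (x y : A),
    phi (upd a i (z *: x + y)) = z * phi (upd a i x) + phi (upd a i y).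

(* (a_0, ..., a_n) |-> (a_0, ..., a_j a_{j+1}, ..., a_n) *)
Definition contract n (a : 'I_n.+1 -> A) (j : 'I_n) : 'I_n -> A :=
  fun i => if (i < j)%N then a (widen_ord (leqnSn n) i)
           else if i == j then a (widen_ord (leqnSn n) i) * a (lift ord0 i)
           else a (lift ord0 i).

(* indices start at 0, so that the j-th contraction has sign (-1)^(j+1) *)
Definition hdiff n (phi : cochain n) : cochain n.+1 := fun a =>
  eps (a ord0) * phi (fun i => a (lift ord0 i))
  + \sum_(j < n) (-1) ^+ j.+1 * phi (contract a j)
  + (-1) ^+ n.+1 * (phi (fun i => a (widen_ord (leqnSn n) i)) * eps (a ord_max)).

Lemma cochainE n z (phi psi : cochain n) a :
  (z *: phi + psi) a = z * phi a + psi a.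
Proof. by []. Qed.

Lemma hdiff_linear n z (phi psi : cochain n) :
  hdiff (z *: phi + psi) = z *: hdiff phi + hdiff psi.
Proof.
apply/funext => a; rewrite cochainE /hdiff !cochainE.
under eq_bigr => j _ do rewrite cochainE mulrDr mulrCA.
rewrite big_split /= -mulr_sumr.
set s := \sum_(_ < _) _; set s' := \sum_(_ < _) _.
rewrite !(mulrDl, mulrDr) !mulrA ![eps _ * z]mulrC ![_ ^+ _ * z]mulrC.
rewrite -!addrA; congr (_ + _); rewrite addrCA; congr (_ + _).
by rewrite [RHS]addrCA; congr (_ + _); rewrite addrCA.
Qed.

Definition is_cocycle n : {pred cochain n} :=
  fun c => `[< multilinear c /\ hdiff c = 0 >].

Lemma is_cocycle_submod n : submod_closed (@is_cocycle n).
Proof.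
split=> [|z c c']; rewrite ?unfold_in /is_cocycle.
  apply/asboolP; split=> [a i z x y|]; first by rewrite mulr0 addr0.
  have := hdiff_linear (-1) (0 : cochain n) 0.
  by rewrite scaler0 addr0 scaleN1r addNr.
move=> /asboolP[m d] /asboolP[m' d']; apply/asboolP; split; last first.
  by rewrite hdiff_linear d d' scaler0 addr0.
move=> a i y x x'.
rewrite !cochainE m m'.
by rewrite !mulrDr addrACA mulrCA.
Qed.
HB.instance Definition _ n := GRing.isSubmodClosed.Build C (cochain n)
  (@is_cocycle n) (@is_cocycle_submod n).

(* Z^n *)
Record cocycle n := Cocycle { cocycle_val : cochain n; _ : cocycle_val \in @is_cocycle n }.
HB.instance Definition _ n := [isSub for @cocycle_val n].
HB.instance Definition _ n := [Choice of cocycle n by <:].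
HB.instance Definition _ n := [SubChoice_isSubLmodule of cocycle n by <:].

(* B^{n+1}, as a subspace of Z^{n+1} *)
Definition is_coboundary n : {pred cocycle n.+1} :=
  fun c => `[< exists2 psi : cochain n, multilinear psi & val c = hdiff psi >].

Lemma is_coboundary_submod n : submod_closed (@is_coboundary n).
Proof.
split=> [|z c c']; rewrite ?unfold_in /is_coboundary.
  apply/asboolP; exists 0 => [a i z x y|]; first by rewrite mulr0 addr0.
  have := hdiff_linear (-1) (0 : cochain n) 0.
  by rewrite scaler0 addr0 scaleN1r addNr => ->.
move=> /asboolP[f m e] /asboolP[f' m' e']; apply/asboolP; exists (z *: f + f').
  move=> a i y x x'.
  rewrite !cochainE m m'.
  by rewrite !mulrDr addrACA mulrCA.
by rewrite hdiff_linear -e -e'.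
Qed.
HB.instance Definition _ n := GRing.isSubmodClosed.Build C (cocycle n.+1)
  (@is_coboundary n) (@is_coboundary_submod n).

(* H^{n+1} = Z^{n+1} / B^{n+1} *)
Definition HH n : Type := @Quotient.quot (cocycle n.+1) (@is_coboundary n).
HB.instance Definition _ n := GRing.Zmodule.on (HH n).
HB.instance Definition _ n := Quotient.on (HH n).

Definition hclass n (c : cocycle n.+1) : HH n := \pi_(HH n) c.

Definition hscale n (z : C) (x : HH n) : HH n := hclass (z *: repr x).

Lemma hclassP n (c c' : cocycle n.+1) :
  hclass c = hclass c' <-> c - c' \in @is_coboundary n.
Proof. by rewrite Quotient.idealrBE; split=> [/eqP|/eqP]. Qed.

Lemma hclassK n (x : HH n) : hclass (repr x) = x.
Proof. exact: reprK. Qed.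

Lemma hclassD n (c c' : cocycle n.+1) : hclass (c + c') = hclass c + hclass c'.
Proof. by rewrite /hclass Quotient.pi_add. Qed.

Lemma hscaleE n z (c : cocycle n.+1) : hscale z (hclass c) = hclass (z *: c).
Proof.
by apply/hclassP; rewrite -scalerBr rpredZ //; apply/hclassP; rewrite hclassK.
Qed.

Lemma hscaleA n a b (x : HH n) : hscale a (hscale b x) = hscale (a * b) x.
Proof. by rewrite -(hclassK x) !hscaleE scalerA. Qed.
Lemma hscale1 n : left_id 1 (@hscale n).
Proof. by move=> x; rewrite -(hclassK x) !hscaleE scale1r. Qed.
Lemma hscaleDr n : right_distributive (@hscale n) +%R.
Proof.
move=> z x y; rewrite -(hclassK x) -(hclassK y).
by rewrite -hclassD !hscaleE -hclassD scalerDr.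
Qed.
Lemma hscaleDl n (x : HH n) : {morph (@hscale n)^~ x : a b / a + b}.
Proof. by move=> a b; rewrite -(hclassK x) !hscaleE -hclassD scalerDl. Qed.
HB.instance Definition _ n := GRing.Zmodule_isLmodule.Build C (HH n)
  (@hscaleA n) (@hscale1 n) (@hscaleDr n) (@hscaleDl n).

End Hochschild.

Section Basis.
Variables (K : fieldType) (V : lmodType K).
Local Open Scope classical_set_scope.

Definition lin_independent (S : set V) : Prop :=
  forall (s : seq V) (c : V -> K), uniq s -> (forall v, v \in s -> S v) ->
    \sum_(v <- s) c v *: v = 0 -> forall v, v \in s -> c v = 0.

Definition spanning (S : set V) : Prop :=
  forall x : V, exists (s : seq V) (c : V -> K),
    (forall v, v \in s -> S v) /\ x = \sum_(v <- s) c v *: v.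

Definition is_basis (S : set V) : Prop := lin_independent S /\ spanning S.

End Basis.

Section SecondCohomology.
Variables (C : numClosedFieldType) (d : nat).

Definition H2 : Type := HH (@counit C d) 1.
HB.instance Definition _ := GRing.Lmodule.on H2.

(* K(eta_V, eta_W)(a (x) b) = conj (eta_V (a^* )) eta_W(b) *)
Definition Kcochain (V W : 'M[C]_d) : cochain (polU C d) 2 :=
  fun a => (eta V (star (a ord0)))^* * eta W (a ord_max).

Lemma Kcochain_cocycle V W : Kcochain V W \in @is_cocycle _ _ (@counit C d) 2.
Proof.
apply/asboolP; split.
  move=> a i z x y; rewrite /Kcochain /upd.
  case: (unliftP ord0 i) => [j|] ->; last first.
    rewrite eqxx /= starD starZ etaD etaZ rmorphD rmorphM /= conjCK.
    by rewrite mulrDl mulrA.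
  rewrite (ord1 j) (_ : lift ord0 ord0 = ord_max); last exact/val_inj.
  by rewrite eqxx /= etaD etaZ mulrDr mulrCA.
apply/funext => a; rewrite /hdiff !big_ord_recl big_ord0 addr0 /Kcochain.
have -> : ord_max = lift ord0 (lift ord0 ord0) :> 'I_3 by exact/val_inj.
have -> : ord_max = lift ord0 ord0 :> 'I_2 by exact/val_inj.
have -> : widen_ord (leqnSn 2) ord0 = ord0 by exact/val_inj.
have -> : widen_ord (leqnSn 2) (lift ord0 ord0) = lift ord0 ord0 by exact/val_inj.
rewrite /contract /=.
have -> : widen_ord (leqnSn 2) ord0 = ord0 by exact/val_inj.
have -> : widen_ord (leqnSn 2) (lift ord0 ord0) = lift ord0 ord0 by exact/val_inj.
move: (a ord0) (a (lift ord0 ord0)) (a (lift ord0 (lift ord0 ord0))) => x y z.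
rewrite expr1 expr2 exprS expr2 mulN1r mulrNN mul1r mulN1r.
rewrite starM !etaM !counit_star rmorphD !rmorphM /= !conjCK.
rewrite [RHS](_ : _ = 0 :> C) //.
ring.
Qed.

(* B^2 is contained in Z^2, so is_coboundary is all of B^2 *)
Lemma hdiff_cocycle (psi : cochain (polU C d) 1) :
  multilinear psi -> hdiff (@counit C d) psi \in @is_cocycle _ _ (@counit C d) 2.
Proof.
move=> lin; pose f x := psi (fun=> x).
have psiE a : psi a = f (a ord0).
  by congr psi; apply/funext => i; rewrite (ord1 i).
have fL z x y : f (z *: x + y) = z * f x + f y.
  have := lin (fun=> 0) ord0 z x y; rewrite !psiE /upd eqxx.
  by [].
have dE a : hdiff (@counit C d) psi a =
    counit (a ord0) * f (a ord_max) - f (a ord0 * a ord_max) + f (a ord0) * counit (a ord_max).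
  rewrite /hdiff big_ord_recl big_ord0 addr0 !psiE /contract /=.
  rewrite (_ : lift ord0 ord0 = ord_max :> 'I_2); last exact/val_inj.
  rewrite (_ : widen_ord (leqnSn 1) ord0 = ord0); last exact/val_inj.
  by rewrite expr1 expr2 mulrNN mul1r mulN1r mul1r.
apply/asboolP; split.
  move=> a i z x y; rewrite !dE /upd.
  case: (unliftP ord0 i) => [j|] ->; last first.
    rewrite eqxx /= counitD counitZ !mulrDl -scalerAl !fL.
    ring.
  rewrite (ord1 j) (_ : lift ord0 ord0 = ord_max); last exact/val_inj.
  rewrite eqxx /= counitD counitZ !mulrDr -scalerAr !fL.
  ring.
apply/funext => a; rewrite {1}/hdiff !big_ord_recl big_ord0 addr0 !dE.
have -> : ord_max = lift ord0 (lift ord0 ord0) :> 'I_3 by exact/val_inj.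
have -> : ord_max = lift ord0 ord0 :> 'I_2 by exact/val_inj.
have w0 : widen_ord (leqnSn 2) ord0 = ord0 by exact/val_inj.
have w1 : widen_ord (leqnSn 2) (lift ord0 ord0) = lift ord0 ord0 by exact/val_inj.
rewrite /contract /= !w0 !w1.
move: (a ord0) (a (lift ord0 ord0)) (a (lift ord0 (lift ord0 ord0))) => x y z.
rewrite !counitM mulrA [RHS](_ : _ = 0 :> C) //.
ring.
Qed.

Definition Kcocycle (V W : 'M[C]_d) : cocycle (@counit C d) 2 :=
  Cocycle (Kcochain_cocycle V W).

Definition Kclass (V W : 'M[C]_d) : H2 := hclass (Kcocycle V W).

(* V_p for 0 <= p < d - 1, rows and columns numbered from 0 *)
Definition Vmx (p : nat) : 'M[C]_d := \matrix_(j, k)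
  if (j == p :> nat) && (k == p :> nat) then 1
  else if (j == p :> nat) && (k == p.+1 :> nat) then 'i
  else if (j == p.+1 :> nat) && (k == p.+1 :> nat) then 1
  else 0.

End SecondCohomology.

(* Main.v *)
(** A 2-cocycle [f] defines an algebra extension [A (+) C] of [A = Pol(U_d^+)],
    and [f] is a coboundary iff this extension splits, i.e. iff [u] and [ubar]
    lift to matrices still satisfying the defining relations. If [v] and [w] are
    lifts of [u] and [u^*], then [v w = I + p] and [w v = I + q] with complex
    matrices [p], [q], and [v (w v) = (v w) v] gives [p = q]; so [u u^* = I] and
    [u^* u = I] impose the same condition, and likewise for [ubar]. What remains
    is a single d x d matrix, the defect of [f], which is traceless. Hence [H^2]
    embeds into [sl_d]. The defect of [K(eta_V, eta_W)] is the commutator [[V^*,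
    W]]: it is [e_mn] for [K_mn] and [e_(p+1)(p+1) - e_pp] for [K_p], and these
    form a basis of [sl_d]. *)

Require Import Defs.
From HB Require Import structures.
From mathcomp Require Import all_boot all_order all_algebra.
From mathcomp Require Import boolp classical_sets functions reals complex.
From mathcomp Require Import ring.

Set Implicit Arguments.
Unset Strict Implicit.
Unset Printing Implicit Defensive.

Import Order.TTheory GRing.Theory Num.Theory.
Local Open Scope ring_scope.
Local Open Scope classical_set_scope.

(** * Bases from dual families of functionals *)

Section DualFamily.
Variables (K : fieldType) (V : lmodType K) (J : finType) (P : pred J).
Variables (b : J -> V) (g : J -> V -> K).
Hypothesis g_linear : forall i z x y, g i (z *: x + y) = z * g i x + g i y.
Hypothesis g_dual : forall i j, P i -> P j -> g i (b j) = (i == j)%:R.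
Hypothesis g_inj : forall x, (forall i, P i -> g i x = 0) -> x = 0.

Let g0 i : g i 0 = 0.
Proof. by have := g_linear i (-1) 0 0; rewrite scaler0 addr0 mulN1r addNr. Qed.

Let gD i : {morph g i : x y / x + y}.
Proof. by move=> x y; have := g_linear i 1 x y; rewrite scale1r mul1r. Qed.

Let gZ i z x : g i (z *: x) = z * g i x.
Proof. by have := g_linear i z x 0; rewrite !addr0 g0 addr0. Qed.

Let g_sum (I : Type) (r : seq I) (Q : pred I) (F : I -> V) i :
  g i (\sum_(k <- r | Q k) F k) = \sum_(k <- r | Q k) g i (F k).
Proof. exact: (big_morph (g i) (gD i) (g0 i)). Qed.

Lemma dual_family_coord (c : J -> K) i :
  P i -> g i (\sum_(j | P j) c j *: b j) = c i.
Proof.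
move=> Pi; rewrite g_sum (bigD1 i) //= gZ g_dual // eqxx mulr1 big1 ?addr0 //.
by move=> j /andP[Pj ji]; rewrite gZ g_dual // eq_sym (negPf ji) mulr0.
Qed.

Lemma dual_family_eq x y : (forall i, P i -> g i x = g i y) -> x = y.
Proof.
move=> h; apply/eqP; rewrite -subr_eq0; apply/eqP/g_inj => i Pi.
by rewrite addrC -scaleN1r g_linear h // mulN1r addNr.
Qed.

Lemma dual_family_expand x : x = \sum_(j | P j) g j x *: b j.
Proof. by apply: dual_family_eq => i Pi; rewrite dual_family_coord. Qed.

Lemma dual_family_basis : is_basis [set x | exists2 i, P i & x = b i].
Proof.
split=> [s c us sb s0 v vs|x].
  have [i Pi vb] := sb v vs; have := congr1 (g i) s0.
  rewrite g_sum g0 (bigD1_seq v) //= gZ {2}vb g_dual // eqxx mulr1 big_seq_cond.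
  rewrite big1 ?addr0 // => w /andP[ws wv]; have [j Pj wb] := sb w ws.
  rewrite gZ wb g_dual //; case: eqP => [ij|_]; last by rewrite mulr0.
  by rewrite vb wb ij eqxx in wv.
(* Coefficients must be a function of the vector, so the coordinates of all [j] with [b j = v] are
   added; duality makes [b] injective on [P], and each such sum has a single term. *)
exists [seq b i | i <- enum P], (fun v => \sum_(j | P j && (b j == v)) g j x).
split=> [v vb|].
  by have /mapP[i0] := vb; rewrite mem_enum => Pi ->; exists i0.
rewrite big_map big_enum /= {1}[x]dual_family_expand.
apply: eq_bigr => i Pi; congr (_ *: _); rewrite (bigD1 i) ?Pi ?eqxx //=.
rewrite big1 ?addr0 // => j /andP[/andP[Pj /eqP bij] ji].
have := g_dual Pj Pj; rewrite {1}bij g_dual // eqxx (negPf ji).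
by move=> /esym/eqP; rewrite oner_eq0.
Qed.

Lemma dual_family_bij (n : nat) : #|P| = n ->
  exists f : {linear V -> 'cV[K]_n}, bijective f.
Proof.
move=> <-; pose f x : 'cV[K]_#|P| := \col_i g (enum_val i) x.
have fL : linear f.
  by move=> z x y; apply/colP => i; rewrite !mxE g_linear.
pose F : {linear V -> 'cV[K]_#|P|} :=
  HB.pack f (GRing.isLinear.Build K V 'cV[K]_#|P| *:%R f fL).
exists F; pose h (v : 'cV[K]_#|P|) := \sum_i v i 0 *: b (enum_val i).
have fh i v : g (enum_val i) (h v) = v i 0.
  rewrite g_sum (bigD1 i) //= gZ g_dual ?eqxx ?mulr1; try exact: enum_valP.
  rewrite big1 ?addr0 // => j ji; rewrite gZ g_dual; try exact: enum_valP.
  by rewrite (inj_eq enum_val_inj) eq_sym (negPf ji) mulr0.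
exists h => [x|v]; last by apply/colP => i; rewrite mxE fh.
apply: dual_family_eq => i Pi.
by rewrite -(enum_rankK_in Pi Pi) fh mxE.
Qed.

End DualFamily.

(** * 2-cochains and 2-cocycles evaluated on pairs *)

Section TwoCochains.
Variables (C : numClosedFieldType) (A : algType C) (eps : A -> C).

(** Stands for the elementary tensor of [a] and [b], as cochains take families indexed by ['I_2]. *)
Definition pair_fam (a b : A) : 'I_2 -> A := fun i => if i == ord0 then a else b.

Lemma pair_famE (f : 'I_2 -> A) : f = pair_fam (f ord0) (f ord_max).
Proof.
apply/funext => i; rewrite /pair_fam; case: eqP => [->//|/eqP].
by case: i => [[|[]]] // h _; congr f; apply/val_inj.
Qed.

Lemma multilinear_pairl (f : cochain A 2) (z : C) x y b : multilinear f ->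
  f (pair_fam (z *: x + y) b) = z * f (pair_fam x b) + f (pair_fam y b).
Proof.
move=> /(_ (pair_fam 0 b) ord0 z x y).
have E w : upd (pair_fam 0 b) ord0 w = pair_fam w b by rewrite [LHS]pair_famE.
by rewrite !E.
Qed.

Lemma multilinear_pairr (f : cochain A 2) (z : C) x y a : multilinear f ->
  f (pair_fam a (z *: x + y)) = z * f (pair_fam a x) + f (pair_fam a y).
Proof.
move=> /(_ (pair_fam a 0) ord_max z x y).
have E w : upd (pair_fam a 0) ord_max w = pair_fam a w by rewrite [LHS]pair_famE.
by rewrite !E.
Qed.

Lemma hdiff1E (psi : cochain A 1) a b : hdiff eps psi (pair_fam a b) =
  eps a * psi (fun=> b) - psi (fun=> a * b) + psi (fun=> a) * eps b.
Proof.
rewrite /hdiff big_ord_recl big_ord0 addr0 expr1 expr2 mulrNN mul1r mulN1r mul1r.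
congr (_ * psi _ - psi _ + psi _ * _); apply/funext => i; rewrite (ord1 i) //.
Qed.

Lemma hdiff2_eq0 (f : cochain A 2) a b c : hdiff eps f = 0 ->
  eps a * f (pair_fam b c) - f (pair_fam (a * b) c) + f (pair_fam a (b * c))
  - f (pair_fam a b) * eps c = 0.
Proof.
pose t (i : 'I_3) := if i == ord0 then a else if i == ord_max then c else b.
move=> /(congr1 (fun h => h t)); rewrite /hdiff !big_ord_recl big_ord0 addr0.
rewrite expr1 expr2 exprS expr2 mulrNN mul1r !mulN1r mul1r addrA => E.
rewrite -[RHS]E; congr (_ * f _ - f _ + f _ - f _ * _);
  by rewrite [RHS]pair_famE; congr pair_fam.
Qed.

End TwoCochains.

Section TwoCocycles.
Variables (C : numClosedFieldType) (A : algType C) (eps : A -> C).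
Variables (f : cochain A 2).
Hypotheses (f_lin : multilinear f) (f_cocycle : hdiff eps f = 0).
Hypothesis eps1 : eps 1 = 1.

Local Notation F a b := (f (pair_fam a b)).

Let FDl x y b : F (x + y) b = F x b + F y b.
Proof. by have := multilinear_pairl 1 x y b f_lin; rewrite scale1r mul1r. Qed.
Let FDr x y a : F a (x + y) = F a x + F a y.
Proof. by have := multilinear_pairr 1 x y a f_lin; rewrite scale1r mul1r. Qed.
Let F0l b : F 0 b = 0.
Proof. by apply: (@addrI _ (F 0 b)); rewrite -FDl !addr0. Qed.
Let F0r a : F a 0 = 0.
Proof. by apply: (@addrI _ (F a 0)); rewrite -FDr !addr0. Qed.

(** Cocycle identity at [(1, 1, b)]. Cocycles are not normalised here: [F 1 1] may be nonzero, so it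
    enters the unit of the extension. *)
Lemma cocycle_1l b : F 1 b = eps b * F 1 1.
Proof.
have /eqP := hdiff2_eq0 1 1 b f_cocycle.
by rewrite !mul1r eps1 mul1r subrr add0r subr_eq0 mulrC => /eqP.
Qed.

Lemma cocycle_1r a : F a 1 = eps a * F 1 1.
Proof.
have /eqP := hdiff2_eq0 a 1 1 f_cocycle.
by rewrite !mulr1 eps1 mulr1 subrK subr_eq0 eq_sym => /eqP.
Qed.

(* The sum over [p, q] of the cocycle identity at [(M j p, N p q, M q k)]. *)
Lemma cocycle_inverse_mx (d : nat) (M N : 'M[A]_d) :
  M *m N = 1%:M -> N *m M = 1%:M ->
  (forall j k, eps (M j k) = (j == k)%:R) ->
  forall j k, \sum_p F (M j p) (N p k) = \sum_p F (N j p) (M p k).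
Proof.
move=> MN NM eM j k.
pose S (x : 'I_d -> 'I_d -> C) := \sum_p \sum_q x p q.
have SD x y : S (fun p q => x p q + y p q) = S x + S y.
  by rewrite /S; under eq_bigr do rewrite big_split /=; rewrite big_split.
have SN x : S (fun p q => - x p q) = - S x.
  by rewrite /S; under eq_bigr do rewrite sumrN; rewrite sumrN.
have E0 : S (fun p q => eps (M j p) * F (N p q) (M q k)
    - F (M j p * N p q) (M q k) + F (M j p) (N p q * M q k)
    - F (M j p) (N p q) * eps (M q k)) = 0.
  by apply: big1 => p _; apply: big1 => q _; exact: hdiff2_eq0.
have E1 : S (fun p q => eps (M j p) * F (N p q) (M q k)) =
    \sum_p F (N j p) (M p k).
  rewrite /S (bigD1 j) //= [X in _ + X]big1 ?addr0 => [|p pj].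
    by apply: eq_bigr => q _; rewrite eM eqxx mul1r.
  by apply: big1 => q _; rewrite eM eq_sym (negPf pj) mul0r.
have E4 : S (fun p q => F (M j p) (N p q) * eps (M q k)) =
    \sum_p F (M j p) (N p k).
  apply: eq_bigr => p _; rewrite (bigD1 k) //= eM eqxx mulr1.
  by rewrite big1 ?addr0 // => q qk; rewrite eM (negPf qk) mulr0.
have Fsuml (I : finType) (x : I -> A) b : \sum_i F (x i) b = F (\sum_i x i) b.
  by rewrite (big_morph (fun y => F y b) (fun y z => FDl y z b) (F0l b)).
have Fsumr (I : finType) (x : I -> A) a : \sum_i F a (x i) = F a (\sum_i x i).
  by rewrite (big_morph (fun y => F a y) (fun y z => FDr y z a) (F0r a)).
(* Summing over [p] first produces the entries of [M *m N], so only [q = j] survives; [E3] is the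
   mirror case with [N *m M]. *)
have E2 : S (fun p q => F (M j p * N p q) (M q k)) = F 1 (M j k).
  rewrite /S exchange_big /= (bigD1 j) //= Fsuml.
  have /matrixP/(_ j j) := MN; rewrite !mxE eqxx => ->.
  rewrite big1 ?addr0 // => q qj; rewrite Fsuml.
  by have /matrixP/(_ j q) := MN; rewrite !mxE eq_sym (negPf qj) => ->; exact: F0l.
have E3 : S (fun p q => F (M j p) (N p q * M q k)) = F (M j k) 1.
  rewrite /S (bigD1 k) //= Fsumr.
  have /matrixP/(_ k k) := NM; rewrite !mxE eqxx => ->.
  rewrite big1 ?addr0 // => p pk; rewrite Fsumr.
  by have /matrixP/(_ p k) := NM; rewrite !mxE (negPf pk) => ->; exact: F0r.
(* The two terms with a unit argument cancel, both being [eps (M j k) * F 1 1]. *)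
move: E0; rewrite !SD !SN E1 E2 E3 E4 cocycle_1l (cocycle_1r (M j k)) subrK.
by move/eqP; rewrite subr_eq0 => /eqP.
Qed.

End TwoCocycles.

(** * The defect matrix, the obstruction to splitting the extension *)

Section Defect.
Variables (C : numClosedFieldType) (d : nat).
Local Notation A := (polU C d).
Local Notation eps := (@counit C d).
Local Notation u j k := (gen C j k).
Local Notation us j k := (star (gen C j k)).

(** If [u j k] and [us k j] are lifted with second coordinates x and y, both [u u^* = I] at [(j, k)]
    and [ubar u^t = I] at [(k, j)] prescribe x + y; the entry is the difference of the two
    prescribed values. *)
Definition defect (f : cochain A 2) : 'M[C]_d := \matrix_(j, k)
  ((\sum_p f (pair_fam (u j p) (us k p))) - \sum_p f (pair_fam (us k p) (u j p))).

Lemma defect_linear : linear defect.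
Proof.
move=> z f h; apply/matrixP => j k; rewrite !mxE mulrBr !mulr_sumr.
rewrite addrACA -opprD -!big_split /=.
by congr (_ - _); apply: eq_bigr.
Qed.

(** The terms linear in [psi] agree in both sums, and the product terms both add up to [psi] at
    [(j == k)%:R]. *)
Lemma defect_coboundary (psi : cochain A 1) :
  multilinear psi -> defect (hdiff eps psi) = 0.
Proof.
move=> lin; pose g x := psi (fun=> x).
have gL z x y : g (z *: x + y) = z * g x + g y.
  have := lin (fun=> 0) ord0 z x y.
  have E w : psi (upd (fun=> 0) ord0 w) = g w.
    by congr psi; apply/funext => i; rewrite (ord1 i).
  by rewrite !E.
have gD x y : g (x + y) = g x + g y by have := gL 1 x y; rewrite scale1r mul1r.
have g0 : g 0 = 0 by apply: (@addrI _ (g 0)); rewrite -gD !addr0.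
have gsum (x : 'I_d -> A) : \sum_i g (x i) = g (\sum_i x i).
  by rewrite (big_morph g gD g0).
apply/matrixP => j k; rewrite !mxE.
have E a b : hdiff eps psi (pair_fam a b) = eps a * g b - g (a * b) + g a * eps b.
  exact: hdiff1E.
under eq_bigr do rewrite E counit_star !counit_gen rmorph_nat.
under [X in _ - X]eq_bigr do rewrite E counit_star !counit_gen rmorph_nat.
rewrite !big_split /= !sumrN !gsum.
have [r1 _ r3 _] := genmx_relations C d.
have -> : \sum_p u j p * us k p = (j == k)%:R.
  have /matrixP/(_ j k) := r1; rewrite !mxE => <-.
  by apply: eq_bigr => p _; rewrite !mxE.
have -> : \sum_p us k p * u j p = (j == k)%:R.
  have /matrixP/(_ k j) := r3; rewrite !mxE [k == j]eq_sym => <-.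
  by apply: eq_bigr => p _; rewrite !mxE.
rewrite !sum_deltal !sum_deltar; ring.
Qed.

Lemma cocycle_gen (f : cochain A 2) : f \in @is_cocycle _ _ eps 2 ->
  forall j k, \sum_p f (pair_fam (u j p) (us k p)) =
              \sum_p f (pair_fam (us p j) (u p k)).
Proof.
move=> /asboolP[fl f0] j k; have [r1 r2 _ _] := genmx_relations C d.
have eg m n : eps (Defs.genmx C d m n) = (m == n)%:R by rewrite mxE counit_gen.
have := cocycle_inverse_mx fl f0 (@counit1 _ _) r1 r2 eg j k.
by congr (_ = _); apply: eq_bigr => p _; rewrite !mxE.
Qed.

Lemma cocycle_gen_star (f : cochain A 2) : f \in @is_cocycle _ _ eps 2 ->
  forall j k, \sum_p f (pair_fam (us j p) (u k p)) =
              \sum_p f (pair_fam (u p j) (us p k)).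
Proof.
move=> /asboolP[fl f0] j k; have [_ _ r3 r4] := genmx_relations C d.
have eg m n : eps (map_mx (@star C d) (Defs.genmx C d) m n) = (m == n)%:R.
  by rewrite !mxE counit_star counit_gen rmorph_nat.
have := cocycle_inverse_mx fl f0 (@counit1 _ _) r3 r4 eg j k.
by congr (_ = _); apply: eq_bigr => p _; rewrite !mxE.
Qed.

(** After [cocycle_gen] both halves of the trace are the same double sum with its indices
    exchanged. *)
Lemma mxtrace_defect (f : cochain A 2) :
  f \in @is_cocycle _ _ eps 2 -> \tr (defect f) = 0.
Proof.
move=> fc; rewrite /mxtrace; under eq_bigr do rewrite mxE cocycle_gen //.
by rewrite sumrB [X in _ - X]exchange_big subrr.
Qed.

Lemma defect_Kcochain (V W : 'M[C]_d) :
  defect (Kcochain V W) =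
  (map_mx Num.conj V)^T *m W - W *m (map_mx Num.conj V)^T.
Proof.
apply/matrixP => j k; rewrite !mxE; congr (_ - _); apply: eq_bigr => p _.
  rewrite /Kcochain /= !mxE !eta_gen_star rmorphN mulrNN //.
by rewrite /Kcochain /= !mxE starK !eta_gen mulrC.
Qed.

Lemma defect0_coboundary (f : cochain A 2) :
  f \in @is_cocycle _ _ eps 2 -> defect f = 0 ->
  exists2 psi : cochain A 1, multilinear psi & f = hdiff eps psi.
Proof.
move=> fc df; have /asboolP[fl f0] := fc.
pose F a b : C := f (pair_fam a b); pose e : C := F 1 1.
have FDl x y b : F (x + y) b = F x b + F y b.
  by have := multilinear_pairl 1 x y b fl; rewrite scale1r mul1r.
have FDr x y a : F a (x + y) = F a x + F a y.
  by have := multilinear_pairr 1 x y a fl; rewrite scale1r mul1r.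
have F1l b : F 1 b = eps b * e by exact: cocycle_1l f0 (@counit1 _ _) b.
have F1r a : F a 1 = eps a * e by exact: cocycle_1r f0 (@counit1 _ _) a.
have F0l b : F 0 b = 0 by apply: (@addrI _ (F 0 b)); rewrite -FDl !addr0.
have F0r a : F a 0 = 0 by apply: (@addrI _ (F a 0)); rewrite -FDr !addr0.
have FZl z x b : F (z *: x) b = z * F x b.
  by have := multilinear_pairl z x 0 b fl; rewrite -!/(F _ _) F0l !addr0.
have FZr z x a : F a (z *: x) = z * F a x.
  by have := multilinear_pairr z x 0 a fl; rewrite -!/(F _ _) F0r !addr0.
have FC a b c : eps a * F b c - F (a * b) c + F a (b * c) - F a b * eps c = 0.
  exact: hdiff2_eq0.
pose P j k : C := \sum_p F (u j p) (us k p).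
have P2 j k : \sum_p F (us p j) (u p k) = P j k by rewrite /P cocycle_gen.
(* Here the vanishing of the defect enters: it ties the relations for [ubar] to those for [u]. *)
have P3 j k : \sum_p F (us j p) (u k p) = P k j.
  by have /matrixP/(_ k j) := df; rewrite !mxE => /eqP; rewrite subr_eq0 => /eqP.
have P4 j k : \sum_p F (u p j) (us p k) = P k j by rewrite -P3 [RHS]cocycle_gen_star.
(* [t |-> (t, h t)] is a homomorphism to the extension with product
   [(a, x)(b, y) = (ab, eps a * y + x * eps b - F a b)] and unit [(1, e)]. *)
pose fix h (t : term C d) : C :=
  match t with
  | TScal z => z * e
  (* With [us] lifted by 0, the second coordinate of [u u^*] at [(j, k)] is [h (TGen j k) - P j k],
     which must equal that of the scalar [(j == k)%:R]. *)
  | TGen j k => P j k + (j == k)%:R * e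
  | TGenS j k => 0
  | TAdd s t => h s + h t
  | TMul s t => teps s * h t + h s * teps t - F (tpi s) (tpi t)
  end.
have h_sum G : h (tsum G) = \sum_p h (G p).
  by apply: (big_morph h (id1 := 0) (op1 := +%R)) => //=; rewrite mul0r.
have Fz z b : F (tpi (TScal d z)) b = z * (eps b * e) by rewrite tpiZ FZl F1l.
have Fz' z b : F b (tpi (TScal d z)) = z * (eps b * e) by rewrite tpiZ FZr F1r.
have dl (G : 'I_d -> C) j : \sum_p (p == j)%:R * G p = G j.
  by rewrite -[RHS]sum_deltal; apply: eq_bigr => p _; rewrite eq_sym.
have dr (G : 'I_d -> C) j : \sum_p G p * (p == j)%:R = G j.
  by rewrite -[RHS]sum_deltar; apply: eq_bigr => p _; rewrite eq_sym.
have usE j k : tpi (TGenS C j k) = us j k by rewrite starE.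
have h_teq s t : teq s t -> h s = h t.
  elim=> {s t} //=.
  - by move=> s t r _ -> _ ->.
  - by move=> s s' t t' _ -> _ ->.
  - move=> s s' t t' es h1 et h2.
    by rewrite (teps_teq es) (teps_teq et) h1 h2 (proj1 (tpiP _ _) es)
      (proj1 (tpiP _ _) et).
  - by move=> *; rewrite addrA.
  - by move=> *; rewrite addrC.
  - by move=> *; rewrite mul0r add0r.
  - by move=> s; rewrite Fz counitE; ring.
  (* Associativity of the extension is the cocycle identity. *)
  - move=> s t r; have := FC (tpi s) (tpi t) (tpi r); rewrite !counitE !tpiM.
    move=> E; apply/eqP.
    by rewrite -subr_eq0 -oppr_eq0 -[X in _ == X]E; apply/eqP; ring.
  - by move=> s; rewrite Fz counitE; ring.
  - by move=> s t r; rewrite tpiD FDl; ring.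
  - by move=> s t r; rewrite tpiD FDr; ring.
  - by move=> *; rewrite mulrDl.
  - by move=> y z; rewrite Fz counitE /=; ring.
  - by move=> z s; rewrite Fz Fz' counitE; ring.
  - move=> j k; rewrite h_sum /=.
    under eq_bigr do rewrite usE mulr0 add0r.
    by rewrite big_split /= sumrN sum_deltar -/(P j k); ring.
  - move=> j k; rewrite h_sum /=.
    under eq_bigr do rewrite usE mul0r addr0.
    by rewrite big_split /= sumrN dl P2; ring.
  - move=> j k; rewrite h_sum /=.
    under eq_bigr do rewrite usE mul0r addr0.
    by rewrite big_split /= sumrN sum_deltal P3 eq_sym; ring.
  - move=> j k; rewrite h_sum /=.
    under eq_bigr do rewrite usE mulr0 add0r.
    by rewrite big_split /= sumrN dr P4 eq_sym; ring.
(* By [h_teq], [h] descends to the quotient; its [TMul] clause is the equation [f = hdiff eps psi]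
   solved for the value of [psi] on a product. *)
pose psi : cochain A 1 := fun a => h (repr (a ord0)).
have psiE a t : a ord0 = tpi t -> psi a = h t.
  by move=> E; rewrite /psi E; apply/h_teq/tpi_repr.
exists psi.
  move=> a i z; elim/polU_ind=> s; elim/polU_ind=> t.
  rewrite (ord1 i) (@psiE _ (TAdd (TMul (TScal d z) s) t)); last first.
    by rewrite /upd eqxx tpiD tpiM tpiZ -scalerAl mul1r.
  rewrite (@psiE _ s) 1?(@psiE _ t) /upd ?eqxx //=.
  by rewrite Fz counitE; ring.
apply/funext => a; rewrite [a]pair_famE.
move: (a ord0) (a ord_max); elim/polU_ind=> s; elim/polU_ind=> t.
rewrite hdiff1E (@psiE (fun=> tpi t) t) // (@psiE (fun=> tpi s) s) //.
rewrite (@psiE _ (TMul s t)) ?tpiM //=.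
by rewrite !counitE -/(F _ _); ring.
Qed.

End Defect.

(** * The defect on cohomology classes and its values on the proposed basis *)

Section DefectClass.
Variables (C : numClosedFieldType) (d : nat).

Definition hdefect (x : H2 C d) : 'M[C]_d := defect (val (repr x)).

(** The chosen representative differs from [c] by a coboundary, whose defect vanishes. *)
Lemma hdefectE (c : cocycle (@counit C d) 2) :
  hdefect (hclass c) = defect (val c).
Proof.
have /hclassP/asboolP[psi lin E] :
  hclass (repr (hclass c)) = hclass c by exact: hclassK.
rewrite /hdefect -[val (repr _)](subrK (val c)) -[_ + val c]addrC.
rewrite -[val c + _]addrC -[_ - _]scale1r defect_linear scale1r.
by rewrite -[_ - _]/(val (repr (hclass c) - c)) E defect_coboundary ?add0r.
Qed.

Lemma hdefect_linear : linear hdefect.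
Proof.
move=> z x y; rewrite -(hclassK x) -(hclassK y).
rewrite [z *: _]hscaleE -hclassD !hdefectE.
exact: defect_linear.
Qed.

Lemma hdefect_eq0 x : hdefect x = 0 -> x = 0.
Proof.
rewrite -(hclassK x) hdefectE => /defect0_coboundary h.
have [psi lin E] := h (valP (repr x)).
have -> : 0 = hclass 0 :> H2 C d.
  by apply: (@addrI _ (hclass (0 : cocycle (@counit C d) 2))); rewrite -hclassD !addr0.
by apply/hclassP; rewrite subr0; apply/asboolP; exists psi.
Qed.

Lemma mxtrace_hdefect x : \tr (hdefect x) = 0.
Proof. exact: mxtrace_defect (valP (repr x)). Qed.

Lemma hdefect_Kclass (V W : 'M[C]_d) : hdefect (Kclass V W) =
  (map_mx Num.conj V)^T *m W - W *m (map_mx Num.conj V)^T.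
Proof. by rewrite hdefectE defect_Kcochain. Qed.

(** The adjoint of [e_lm] is [e_ml]; then [e_ml e_ln = e_mn], while [e_ln e_ml = 0] because
    [m != n]. Hence the free choice of [l]. *)
Lemma hdefect_Kdelta (l m n : 'I_d) : m != n ->
  hdefect (Kclass (delta_mx l m) (delta_mx l n)) = delta_mx m n.
Proof.
move=> mn; rewrite hdefect_Kclass map_delta_mx trmx_delta !mul_delta_mx_cond.
by rewrite eqxx eq_sym (negPf mn) subr0.
Qed.

(** On the block of [p] and [q], [V_p = I + iN] with [N = e_pq]. The identity commutes with
    everything, leaving [[-iN^*, iN] = N^* N - N N^* = e_qq - e_pp]. *)
Lemma hdefect_Vmx (p q : 'I_d) : q = p.+1 :> nat ->
  hdefect (Kclass (Vmx C d p) (Vmx C d p)) = delta_mx q q - delta_mx p p.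
Proof.
move=> qp; have pq : (p == q) = false.
  by rewrite -val_eqE /= qp ltn_eqF.
have -> : Vmx C d p = delta_mx p p + 'i *: delta_mx p q + delta_mx q q.
  apply/matrixP => j k; rewrite !mxE -qp !val_eqE.
  have [->|jp] := eqVneq j p; rewrite ?pq /=.
    by case: (eqVneq k p) => [->|_]; rewrite ?pq; [|case: (k == q)];
      rewrite /= ?(mulr0, mulr1, addr0, add0r).
  by case: (j == q); case: (k == q); rewrite /= mulr0 !add0r.
rewrite hdefect_Kclass !map_mxD map_mxZ !map_delta_mx /= conjCi.
rewrite !linearD !linearZ /= !trmx_delta.
rewrite !(mulmxDl, mulmxDr) -!(scalemxAl, scalemxAr) !mul_delta_mx_cond.
rewrite !eqxx pq eq_sym pq !mulr0n !mulr1n.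
apply/matrixP => j k; rewrite !mxE; have i2 := sqrCi C.
ring: i2.
Qed.

(* Coordinates of the defect in the basis of [sl_d] made of the [e_mn] (at
   index [(m, n)]) and [e_(p+1)(p+1) - e_pp] (at index [(p, p)], [p] not
   maximal). *)
Definition hcoord (mn : 'I_d * 'I_d) (x : H2 C d) : C :=
  if mn.1 == mn.2 then - \sum_(q < d | (q <= mn.1)%N) hdefect x q q
  else hdefect x mn.1 mn.2.

Lemma hcoord_linear mn z x y : hcoord mn (z *: x + y) = z * hcoord mn x + hcoord mn y.
Proof.
rewrite /hcoord hdefect_linear; move: (hdefect x) (hdefect y) => M N.
case: ifP => _; last by rewrite !mxE.
by under eq_bigr do rewrite !mxE; rewrite big_split /= -mulr_sumr opprD mulrN.
Qed.

Definition hbasis (l : 'I_d -> 'I_d -> 'I_d) (mn : 'I_d * 'I_d) : H2 C d :=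
  if mn.1 == mn.2 then Kclass (Vmx C d mn.1) (Vmx C d mn.1)
  else Kclass (delta_mx (l mn.1 mn.2) mn.1) (delta_mx (l mn.1 mn.2) mn.2).

End DefectClass.

(** * Duality between [hcoord] and [hbasis] *)

Section Basis.
Variables (C : numClosedFieldType) (d : nat) (l : 'I_d.+1 -> 'I_d.+1 -> 'I_d.+1).

(** The last diagonal index has no matrix [V_p]; removing it leaves as many indices as the dimension
    of the traceless matrices. *)
Local Notation P := (predC1 (ord_max, ord_max) : pred ('I_d.+1 * 'I_d.+1)).

Lemma hcoord_hbasis i j : P i -> P j -> @hcoord C _ i (hbasis C l j) = (i == j)%:R.
Proof.
case: i j => [m n] [r s] /=; rewrite !xpair_eqE => mn rs.
rewrite /hcoord /hbasis /=; have [rs'|rs'] := eqVneq r s; last first.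
  rewrite hdefect_Kdelta //; have [mn'|mn'] := eqVneq m n; last by rewrite mxE.
  rewrite big1 => [|q _].
    rewrite oppr0; case: eqP => // mr; case: eqP => // ns.
    by rewrite -mr -ns mn' eqxx in rs'.
  rewrite mxE; case: eqP => // qr; case: eqP => // qs.
  by rewrite -qr -qs eqxx in rs'.
rewrite -{s}rs' in rs *; have rd : (r < d)%N.
  rewrite andbb in rs; rewrite ltn_neqAle -ltnS ltn_ord andbT.
  by apply: contraNneq rs => h; apply/eqP/val_inj.
have rd' : (r.+1 < d.+1)%N by [].
rewrite (@hdefect_Vmx _ _ r (Ordinal rd')) //.
have [mn'|mn'] := eqVneq m n; last first.
  have off t : (m == t) && (n == t) = false.
    by apply: contraNF mn' => /andP[/eqP-> /eqP->].
  by rewrite !mxE !off subrr.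
(* The partial diagonal sum of [e_(r+1)(r+1) - e_rr] up to [m] is [(r < m) - (r <= m)], that is -1
   for [m = r] and 0 otherwise; this explains the sign in [hcoord]. *)
have sumd (t : 'I_d.+1) (k : nat) :
  \sum_(q < d.+1 | (q <= k)%N) (delta_mx t t : 'M[C]_d.+1) q q = (t <= k)%:R.
  have [tk|tk] := leqP t k.
    rewrite (bigD1 t) //= mxE eqxx big1 ?addr0 // => q /andP[_ /negPf qt].
    by rewrite mxE qt.
  rewrite big1 // => q qk; rewrite mxE andbb; case: eqP => // qt.
  by rewrite qt leqNgt tk in qk.
under eq_bigr do rewrite mxE [X in _ + X]mxE.
rewrite sumrB !sumd /= -mn' andbb -val_eqE /= opprB.
by case: ltngtP => _; rewrite ?subr0 ?subrr.
Qed.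

(** Off-diagonal entries of the defect are coordinates. The proper partial sums of its diagonal are
    coordinates up to sign and the full sum is the trace, so all vanish, and so do their successive
    differences, the diagonal entries. *)
Lemma hcoord_inj (x : H2 C d.+1) : (forall i, P i -> hcoord i x = 0) -> x = 0.
Proof.
move=> h; apply: hdefect_eq0; set M := hdefect x.
pose S k := \sum_(q < d.+1 | (q < k)%N) M q q.
have S0 k : (k <= d.+1)%N -> S k = 0.
  case: k => [_|k]; first by rewrite /S big_pred0.
  rewrite ltnS leq_eqVlt => /orP[/eqP ->|kd].
    rewrite -[RHS](mxtrace_hdefect x); apply: eq_bigl => q; exact: ltn_ord.
  have kd' : (k < d.+1)%N by exact: ltnW.
  have := h (Ordinal kd', Ordinal kd'); rewrite /hcoord /= eqxx.
  rewrite xpair_eqE andbb -val_eqE /= ltn_eqF // => /(_ isT)/eqP.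
  by rewrite oppr_eq0 => /eqP.
apply/matrixP => m n; rewrite [RHS]mxE; have [<-|mn] := eqVneq m n; last first.
  have := h (m, n); rewrite /hcoord /= (negPf mn) -/M; apply.
  by apply: contraNneq mn => -[-> ->].
have := S0 m.+1 (ltn_ord m); rewrite /S (bigD1 m) //= => E.
rewrite -[RHS]E -[LHS]addr0 -[X in _ + X = _](S0 m (ltnW (ltn_ord m))).
congr (_ + _).
by apply: eq_bigl => q; rewrite ltnS [RHS]andbC ltn_neqAle -val_eqE.
Qed.

End Basis.

Theorem theorem4p6 (R : realType) (d : nat) (hd : (0 < d)%N) :
  (exists f : {linear H2 R[i] d -> 'cV[R[i]]_(d ^ 2 - 1)}, bijective f) /\
  ((2 <= d)%N -> forall l : 'I_d -> 'I_d -> 'I_d,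
    is_basis
      ([set x : H2 R[i] d | exists m n : 'I_d, m != n /\
          x = Kclass (delta_mx (l m n) m) (delta_mx (l m n) n)]
       `|` [set x : H2 R[i] d | exists p : nat, (p < d - 1)%N /\
          x = Kclass (Vmx R[i] d p) (Vmx R[i] d p)])).
Proof.
case: d hd => // d _; split.
  (* The dimension may be computed with any [l]; here [l m n = m]. *)
  have := dual_family_bij (@hcoord_linear _ _)
    (@hcoord_hbasis R[i] d (fun m _ => m)) (@hcoord_inj _ _).
  by apply; rewrite cardC1 card_prod card_ord subn1 mulnn.
move=> _ l; have := dual_family_basis (@hcoord_linear _ _)
  (@hcoord_hbasis R[i] d l) (@hcoord_inj _ _).
(* Off-diagonal indices match the [K_mn], diagonal ones the [K_p]; excluding the last index is the
   bound on [p]. *)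
congr is_basis; apply/seteqP; split=> x /=.
  move=> [[m n] /= mn ->]; rewrite /hbasis /=; case: eqVneq => [mn'|mn'].
    right; exists m; split=> //; rewrite subn1 /= ltn_neqAle -ltnS ltn_ord andbT.
    by apply: contraNneq mn => h; rewrite -mn' xpair_eqE andbb; apply/eqP/val_inj.
  by left; exists m, n.
case=> [[m [n [mn ->]]]|[p [pd ->]]].
  exists (m, n); last by rewrite /hbasis /= (negPf mn).
  by rewrite /= xpair_eqE; apply: contra mn => /andP[/eqP-> /eqP->].
rewrite subn1 /= in pd; have pd' := ltnW pd : (p < d.+1)%N.
exists (Ordinal pd', Ordinal pd'); last by rewrite /hbasis /= eqxx.
by rewrite /= xpair_eqE andbb -val_eqE /= ltn_eqF.
Qed.
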